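(* (Adaptive case.) Let $\mathcal P=\{P_{\theta,G}:\theta\in\Theta,\ G\in\mathcal G\}$ be a semiparametric model, $\Theta\subset\mathbb R^k$ open, $\mathcal G$ a subset of a Hilbert space $\mathcal H$, and let $\nu(P_{\theta,G})=\tilde\nu(G)$ with $\tilde\nu:\mathcal G\to\mathcal B$, $\mathcal B$ a Banach space. Fix $\theta_0\in\Theta$, $G\in\mathcal G$ and $\mathcal B_0^*\subset\mathcal B^*$. Suppose that for an appropriately chosen collection $\mathcal C_G$ of paths in $\mathcal G$ through $G$ (all notions as defined in the context): (1) $\mathcal P_1(G)=\{P_{\theta,G}:\theta\in\Theta\}$ is a regular parametric model and $\mathcal P$ is Hellinger differentiable at $P_{\theta,G}$, $\theta\in\Theta$; $\dot{\mathcal G}^0$ is a closed linear subspace of $\mathcal H$, i.e. $\dot{\mathcal G}=\dot{\mathcal G}^0$; $\tilde\nu$ is pathwise differentiable at $G$; the efficient information matrix $I_*(\theta)$ is nonsingular; (2) $\dot{\tilde\nu}_{b^*}\in R(\dot l_2^\top(\theta,G)\dot l_2(\theta,G))$ for all $b^*\in\mathcal B^*$, at $\theta=\theta_0$ (and at $\theta$ near $\theta_0$, so that the functions below are defined); (3) for every $h\in\dot{\mathcal G}$ and all sequences $\{\theta_n\}\subset\Theta$ with $\{\sqrt n(\theta_n-\theta_0)\}$ bounded, $$\Bigl|\frac1{\sqrt n}\sum_{i=1}^n\psi_h(X_i;\theta_n,G)-\frac1{\sqrt n}\sum_{i=1}^n\psi_h(X_i;\theta_0,G)\Bigr|\to0\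 \text{ in }P_{\theta_0,G}\text{-probability};$$ (4) the submodel estimator $\hat\nu_{\theta,n}=u_n(X_1,\dots,X_n;\theta)$ is $\mathcal B_0^*$-weakly locally submodel efficient at $P_{\theta_0,G}$: for every sequence $\{\theta_n\}\subset\Theta$ with $\{\sqrt n(\theta_n-\theta_0)\}$ bounded and every $b^*\in\mathcal B_0^*$, $$\sqrt n\Bigl|b^*(\hat\nu_{\theta_n,n}-\tilde\nu(G))-\frac1n\sum_{i=1}^n\psi(X_i;\theta_n,G;b^* )\Bigr|\to0\ \text{ in }P_{\theta_0,G}\text{-probability};$$ (5) $\hat\theta_n=t_n(X_1,\dots,X_n)$ is a $\sqrt n$-consistent estimator of $\theta$ at $\theta_0$ (i.e. $\sqrt n(\hat\theta_n-\theta_0)$ is bounded in $P_{\theta_0,G}$-probability); (6) the components of $\dot l_1(\theta_0)$ are orthogonal to $\dot{\mathcal P}_2(\theta_0)$ in $L_2(P_{\theta_0,G})$. Let $\{\lambda_n\}$ be integers with $0<\liminf_n\lambda_n/n\le\limsup_n\lambda_n/n<1$, put $\tilde\theta_{n1}=t_{\lambda_n}(X_1,\dots,X_{\lambda_n})$, $\tilde\theta_{n2}=t_{n-\lambda_n}(X_{\lambda_n+1},\dots,X_n)$ and $$\hat\nu_n=\frac{\lambda_n}n\,u_{\lambda_n}(X_1,\dots,X_{\lambda_n};\tilde\theta_{n2})+\frac{n-\lambda_n}n\,u_{n-\lambda_n}(X_{\lambda_n+1},\dots,X_n;\tilde\theta_{n1}).$$ Then $\hat\nu_n$ is a weakly efficient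 estimator of $\nu$ within the full model $\mathcal P$ at $P_{\theta_0,G}$; that is, for every sequence $\{\theta_n\}\subset\Theta$ with $\{\sqrt n(\theta_n-\theta_0)\}$ bounded and every $b^*\in\mathcal B_0^*$, $$\sqrt n\Bigl|b^*(\hat\nu_n-\nu(P_{\theta_n,G}))-\frac1n\sum_{i=1}^n\psi(X_i;\theta_n,G;b^* )\Bigr|\to0\ \text{ in }P_{\theta_0,G}\text{-probability}.$$
   Context: $X_1,X_2,\dots$ are i.i.d. with distribution $P_{\theta,G}$ on $(\mathcal X,\mathcal A)$; $s(\theta,G)$ is the square root of the density of $P_{\theta,G}$ with respect to a $\sigma$-finite dominating measure $\mu$ (of the submodel or path considered). $L_2^0(P)=\{f\in L_2(P):\int f\,dP=0\}$. $\mathcal B^*$ is the dual of $\mathcal B$, $R(A)$ the range of an operator $A$, $A^\top$ its adjoint. Statistics are measurable; measurable versions of the $L_2$-functions below (jointly in $(x,\theta)$) are fixed. Regular parametric model: $\{P_\theta:\theta\in\Theta\}$ with root densities $s(\theta)$ w.r.t. a $\sigma$-finite $\mu$ is regular if (i) for all $\theta$ there is a $k$-vector $\dot l(\theta)$ of functions in $L_2(P_\theta)$ with $s(\tilde\theta)=s(\theta)+\frac12(\tilde\theta-\theta)^\top\dot l(\theta)s(\theta)+o(|\tilde\theta-\theta|)$ in $L_2(\mu)$; (ii) $\int\dot l\dot l^\top(\theta)\,dP_\theta$ is nonsingular for all $\theta$; (iii) $\theta\mapsto\dot l(\theta)s(\theta)$ is continuous into $L_2^k(\mu)$. The score vector of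 $\mathcal P_1(G)$ is denoted $\dot l_1(\theta)=\dot l_1(\theta,G)$. Paths: a path in $\mathcal G$ through $G$ is a set $\{G_\eta:|\eta|<1\}\subset\mathcal G$ with $G_0=G$ and $\eta\mapsto G_\eta\in\mathcal H$ continuously Fréchet differentiable with nonvanishing derivative; its tangent is $\dot G\in\mathcal H$ with $G_\eta=G+\eta\dot G+o(\eta)$. $\dot{\mathcal G}^0$ is the set of tangents of paths in $\mathcal C_G$ (with $0$ adjoined), $\dot{\mathcal G}$ its closed linear span in $\mathcal H$. Pathwise differentiability of $\tilde\nu$ at $G$: there is a bounded linear $\dot{\tilde\nu}:\dot{\mathcal G}\to\mathcal B$ with $\|\tilde\nu(G_\eta)-\tilde\nu(G)-\eta\dot{\tilde\nu}(\dot G)\|_{\mathcal B}=o(\eta)$ for all paths in $\mathcal C_G$. For $b^*\in\mathcal B^*$ the gradient $\dot{\tilde\nu}_{b^*}\in\dot{\mathcal G}$ is the unique element with $b^*(\dot{\tilde\nu}(\dot G))=\langle\dot{\tilde\nu}_{b^*},\dot G\rangle_{\mathcal H}$ for all $\dot G\in\dot{\mathcal G}$. Hellinger differentiability at $P_{\theta,G}$: there is a bounded linear $\dot l:\mathbb R^k\times\dot{\mathcal G}\to L_2^0(P_{\theta,G})$ such that for all $\zeta\in\mathbb R^k$ and paths in $\mathcal C_G$ with tangent $\dot G$, $s(\theta+\eta\zeta,G_\eta)=s(\theta,G)+\frac12\eta\,\dot l(\zeta,\dot G)s(\theta,G)+o(\eta)$ in $L_2(\mu)$. Then $\dot l(\zeta,\dot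 G)=\dot l_1^\top\zeta+\dot l_2(\dot G)$, which defines the score operator $\dot l_2=\dot l_2(\theta,G):\dot{\mathcal G}\to L_2^0(P_{\theta,G})$. $\dot{\mathcal P}_2=\dot{\mathcal P}_2(\theta)$ is the closed linear span in $L_2^0(P_{\theta,G})$ of the functions $\dot l_2(\dot G)$ obtained from paths in $\mathcal C_G$ (tangent space of the submodel with $\theta$ known). Efficient score and information: $l_1^*(\theta)=\dot l_1(\theta)-\Pi(\dot l_1(\theta)\mid\dot{\mathcal P}_2)$ (componentwise $L_2(P_{\theta,G})$-projection), $I_*(\theta)=E_\theta(l_1^*l_1^{*\top})$. Influence functions: $(\dot l_2^\top\dot l_2)^-\alpha$ denotes any solution $h\in\dot{\mathcal G}$ of $\dot l_2^\top\dot l_2h=\alpha$. Put $\psi_h(x;\theta,G)=[\dot l_2(\theta,G)(\dot l_2^\top(\theta,G)\dot l_2(\theta,G))^-h](x)$ for $h\in\dot{\mathcal G}$ for which this is defined (i.e. $h\in R(\dot l_2^\top\dot l_2)$), and $\psi(x;\theta,G;b^* )=\psi_h(x;\theta,G)$ with $h=\dot{\tilde\nu}_{b^*}$. *)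

(* Defs.v *)
From HB Require Import structures.
From mathcomp Require Export all_boot all_order all_algebra finmap.
From mathcomp Require Export all_classical all_reals all_analysis.

Set Implicit Arguments.
Unset Strict Implicit.
Unset Printing Implicit Defensive.

Export Order.TTheory GRing.Theory Num.Theory.
Export numFieldNormedType.Exports.

#[global] Open Scope classical_set_scope.
#[global] Open Scope ring_scope.

(** The Borel sigma-algebra of a topological space. *)
Notation borel T := (g_sigma_algebraType (@open T)).

Section hilbert.
Context {R : realType} {H : completeNormedModType R}.

(** [H] with [ip] is a real Hilbert space: completeness is part of the type of
    [H], and the last clause says that its norm is the one given by [ip]. *)
Definition inner_product (ip : H -> H -> R) : Prop :=
  [/\ forall x y, ip x y = ip y x,
      forall a x y z, ip (a *: x + y) z = a * ip x z + ip y z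
    & forall x, ip x x = `|x| ^+ 2].

Definition linear_subspace (S : set H) : Prop :=
  S 0 /\ forall (a : R) x y, S x -> S y -> S (a *: x + y).

Definition linear_span (S : set H) : set H :=
  [set x | exists (n : nat) (a : 'I_n -> R) (v : 'I_n -> H),
     (forall i, S (v i)) /\ x = \sum_(i < n) a i *: v i].

Definition closed_linear_span (S : set H) : set H := closure (linear_span S).

(** A path [{G_eta : |eta| < 1}] is a function on [R] of which only the values
    on [(-1, 1)] matter.  Continuity of the Frechet derivative, as a map into
    the bounded operators from [R] to [H], is continuity of [derive1 g]. *)
Definition is_path (calG : set H) (G : H) (g : R -> H) : Prop :=
  g 0 = G /\ forall eta : R, `|eta| < 1 ->
    [/\ calG (g eta), differentiable g eta,
        {for eta, continuous (derive1 g)} & derive1 g eta != 0].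

Definition tangent (g : R -> H) : H := derive1 g 0.

Definition tangent_set (CG : set (R -> H)) : set H :=
  [set 0] `|` [set tangent g | g in CG].

Definition tangent_space (CG : set (R -> H)) : set H :=
  closed_linear_span (tangent_set CG).

End hilbert.

Section pathwise.
Context {R : realType} {H B : completeNormedModType R}.

Definition dual : set {scalar B} := [set b | continuous (b : B -> R)].

Definition pathwise_derivative (CG : set (R -> H)) (G : H) (nut : H -> B)
    (nudot : H -> B) : Prop :=
  [/\ forall (a : R) h h', tangent_space CG h -> tangent_space CG h' ->
        nudot (a *: h + h') = a *: nudot h + nudot h',
      exists M : R, forall h, tangent_space CG h -> `|nudot h| <= M * `|h|
    & forall g, CG g ->
        (fun eta : R =>
           eta^-1 *: (nut (g eta) - nut G - eta *: nudot (tangent g)))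
          @ 0^' --> (0 : B)].

(** The Riesz representative in [tangent_space CG] of [b \o nudot]. *)
Definition gradient (ip : H -> H -> R) (CG : set (R -> H)) (nudot : H -> B)
    (b : {scalar B}) : H :=
  get [set k | tangent_space CG k /\
               forall h, tangent_space CG h -> b (nudot h) = ip k h].

End pathwise.
Arguments dual {R} B.

Section L2.
Context {R : realType} {d : measure_display} {X : measurableType d}.
Implicit Types (P : probability X R) (f : X -> R).

(** Elements of [L_2] are represented by measurable functions; equalities
    between them are almost everywhere. *)
Definition L2norm (mu : {measure set X -> \bar R}) f : \bar R :=
  'N[mu]_(2%:E)[EFin \o f].

Definition L2 P : set (X -> R) := [set f | f \in Lfun P 2%:E].

Definition L20 P : set (X -> R) := [set f | L2 P f /\ \int[P]_x f x = 0].

Definition L2dot P (f g : X -> R) : R := \int[P]_x (f x * g x).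

Definition L20_closed_linear_span P (S : set (X -> R)) : set (X -> R) :=
  [set f | L20 P f /\ forall eps : R, 0 < eps ->
     exists (n : nat) (a : 'I_n -> R) (v : 'I_n -> X -> R),
       (forall i, S (v i)) /\
       (L2norm P (fun x => f x - \sum_(i < n) a i * v i x)%R < eps%:E)%E].

(** A version of the orthogonal projection of [f] on [S] in [L_2(P)]. *)
Definition L2proj P (S : set (X -> R)) f : X -> R :=
  xget (cst 0) [set p | S p /\
    forall q, S q -> L2dot P (fun x => f x - p x) q = 0].

Definition bounded_linear_into_L20 (V : normedModType R) P (D : set V)
    (A : V -> X -> R) : Prop :=
  [/\ forall v, D v -> L20 P (A v),
      forall (a : R) v w, D v -> D w ->
        A (a *: v + w) = (fun x => a * A v x + A w x) %[ae P]
    & exists M : R, forall v, D v -> (L2norm P (A v) <= (M * `|v|)%:E)%E].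

(** [s] is the square root of a density of [P] with respect to [mu]. *)
Definition root_density (mu : {measure set X -> \bar R}) P (s : X -> R) : Prop :=
  [/\ measurable_fun setT s, forall x, 0 <= s x
    & forall A, measurable A -> P A = (\int[mu]_(x in A) (s x ^+ 2)%:E)%E].

Definition second_moment_matrix (k : nat) P (l : 'I_k -> X -> R) : 'M[R]_k :=
  \matrix_(i, j) L2dot P (l i) (l j).

(** [{P th : th in Theta}] is a regular parametric model with score vector
    [l]. *)
Definition regular_model (k : nat) (Theta : set 'rV[R]_k)
    (P : 'rV[R]_k -> probability X R) (l : 'rV[R]_k -> 'I_k -> X -> R) : Prop :=
  exists (mu : {sigma_finite_measure set X -> \bar R})
         (s : 'rV[R]_k -> X -> R),
    (forall th, Theta th -> root_density mu (P th) (s th)) /\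
    forall th, Theta th ->
    [/\ forall j, L2 (P th) (l th j),
        (fun th' => L2norm mu (fun x => s th' x - s th x
             - 2^-1 * (\sum_(j < k) (th' - th) 0 j * l th j x) * s th x)%R
           * (`|th' - th|^-1)%:E)%E @ th^' --> 0%E,
        second_moment_matrix (P th) (l th) \in unitmx
      & forall j, (fun th' => L2norm mu
             (fun x => l th' j x * s th' x - l th j x * s th x))
           @ th --> 0%E].

End L2.

Section semiparametric.
Context {R : realType} {d : measure_display} {X : measurableType d}.
Context {H : completeNormedModType R} {k : nat}.
Variables (Theta : set 'rV[R]_k) (P : 'rV[R]_k -> H -> probability X R).
Variables (ip : H -> H -> R) (CG : set (R -> H)) (G : H).

(** [ldot] is the Hellinger derivative at [P th G]; the dominating measure may
    depend on the direction [zeta] and on the path [g]. *)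
Definition hellinger_derivative (th : 'rV[R]_k)
    (ldot : 'rV[R]_k * H -> X -> R) : Prop :=
  bounded_linear_into_L20 (P th G) (setT `*` tangent_space CG) ldot /\
  forall (zeta : 'rV[R]_k) (g : R -> H), CG g ->
    exists (mu : {sigma_finite_measure set X -> \bar R}) (s : R -> X -> R),
      (forall eta : R, `|eta| < 1 -> Theta (th + eta *: zeta) ->
         root_density mu (P (th + eta *: zeta) (g eta)) (s eta)) /\
      (fun eta : R => L2norm mu (fun x => s eta x - s 0 x
           - 2^-1 * eta * ldot (zeta, tangent g) x * s 0 x)%R
         * (`|eta|^-1)%:E)%E @ 0^' --> 0%E.

(** From here on, [l1 th] is the score vector of [{P th G : th in Theta}] and
    [ldot th] the Hellinger derivative at [P th G]. *)
Variables (l1 : 'rV[R]_k -> 'I_k -> X -> R).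
Variables (ldot : 'rV[R]_k -> 'rV[R]_k * H -> X -> R).

Definition score_operator (th : 'rV[R]_k) (h : H) : X -> R := ldot th (0, h).

Definition score_decomposition (th : 'rV[R]_k) : Prop :=
  forall (zeta : 'rV[R]_k) h, tangent_space CG h ->
    ldot th (zeta, h) =
      (fun x => \sum_(j < k) l1 th j x * zeta 0 j + score_operator th h x)
      %[ae P th G].

(** The tangent space of the submodel in which [th] is known. *)
Definition nuisance_tangent_space (th : 'rV[R]_k) : set (X -> R) :=
  L20_closed_linear_span (P th G)
    [set score_operator th (tangent g) | g in CG].

Definition efficient_score (th : 'rV[R]_k) (j : 'I_k) : X -> R :=
  fun x => l1 th j x
           - L2proj (P th G) (nuisance_tangent_space th) (l1 th j) x.

Definition efficient_information (th : 'rV[R]_k) : 'M[R]_k :=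
  second_moment_matrix (P th G) (efficient_score th).

(** The adjoint [L_2^0(P th G) -> tangent_space CG] of the score operator; its
    values exist and are unique by the Riesz representation theorem. *)
Definition score_adjoint (th : 'rV[R]_k) (f : X -> R) : H :=
  get [set a | tangent_space CG a /\ forall h, tangent_space CG h ->
                 ip a h = L2dot (P th G) f (score_operator th h)].

Definition information_operator (th : 'rV[R]_k) (h : H) : H :=
  score_adjoint th (score_operator th h).

(** The first conjunct only restates that the operator takes its values in
    [tangent_space CG]. *)
Definition information_range (th : 'rV[R]_k) : set H :=
  [set a | tangent_space CG a /\
     exists2 h, tangent_space CG h & information_operator th h = a].

(** [psi a th] is a version of [score_operator th h] for any solution [h] of
    [information_operator th h = a]; where there is no solution, [psi a th] is
    unconstrained up to measurability. *)
Definition influence_functions (psi : H -> 'rV[R]_k -> X -> R) : Prop :=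
  forall a, tangent_space CG a ->
    measurable_fun ((Theta : set (borel 'rV[R]_k)) `*` setT)
      (fun p : borel 'rV[R]_k * X => psi a p.1 p.2) /\
    forall th h, Theta th -> tangent_space CG h ->
      information_operator th h = a ->
      psi a th = score_operator th h %[ae P th G].

End semiparametric.

Section sampling.
Context {R : realType} {d : measure_display} {X : measurableType d}.
Context {d' : measure_display} {W : measurableType d'}.
Variable Q : probability W R.

(** The [Xs i] are mutually independent with common distribution [P]. *)
Definition iid (P : probability X R) (Xs : nat -> {mfun W >-> X}) : Prop :=
  (forall i A, measurable A -> Q (Xs i @^-1` A) = P A) /\
  forall (J : {fset nat}) (A : nat -> set X),
    (forall j, measurable (A j)) ->
    Q (\bigcap_(j in [set` J]) Xs j @^-1` A j) =
    (\prod_(j <- J) Q (Xs j @^-1` A j))%E.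

Definition cvg0_in_probability (Z : nat -> W -> R) : Prop :=
  forall eps : R, 0 < eps ->
    (fun n => Q [set w | eps <= `|Z n w|]) @ \oo --> 0%E.

Definition bounded_in_probability (V : normedModType R) (Z : nat -> W -> V)
    : Prop :=
  forall eps : R, 0 < eps ->
    exists M : R, forall n, (Q [set w | (M < `|Z n w|)%R] < eps%:E)%E.

(** [(X_{m+1}, ..., X_{m+n})], the sequence [Xs 0, Xs 1, ...] standing for
    [X_1, X_2, ...]. *)
Definition block (Xs : nat -> {mfun W >-> X}) (m n : nat) (w : W)
    : n.-tuple X :=
  [tuple Xs (m + i)%N w | i < n].

Definition root_n_bounded (k : nat) (Theta : set 'rV[R]_k) (th0 : 'rV[R]_k)
    (th : nat -> 'rV[R]_k) : Prop :=
  (forall n, Theta (th n)) /\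
  exists M : R, forall n, `|Num.sqrt n%:R *: (th n - th0)| <= M.

Definition split_estimator (B : completeNormedModType R) (k : nat)
    (u : forall n, n.-tuple X -> 'rV[R]_k -> B)
    (t : forall n, n.-tuple X -> 'rV[R]_k)
    (lam : nat -> nat) (Xs : nat -> {mfun W >-> X}) (n : nat) (w : W) : B :=
  let m := lam n in
  let x1 := block Xs 0 m w in
  let x2 := block Xs m (n - m) w in
  (m%:R / n%:R) *: u m x1 (t _ x2) + ((n - m)%:R / n%:R) *: u _ x2 (t m x1).

End sampling.

(* Main.v *)
From HB Require Import structures.
From mathcomp Require Import measurable_realfun ring lra.
Require Import Defs.

(** Let [h] be the gradient of [b] and
    [F n x th = sqrt n * b (u n x th - nut G) - (sum_i psi h th0 x_i) / sqrt n].
    Hypotheses (3) and (4) together say that [F n (X_1, ..., X_n) (th n)] tends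
    to [0] in probability along every root-n-bounded sequence [th], which is the
    same as convergence uniformly in [th] with [sqrt n * |th - th0| <= M].  An
    estimator computed from an independent block whose size is comparable to [n]
    is root-n-consistent, so by Fubini it may be substituted for [th].  Up to the
    error term of (3), the quantity to be bounded is a combination with
    coefficients [sqrt (lam n / n)] and [sqrt ((n - lam n) / n)] of two such
    substituted terms, one for each half of the sample. *)

Set Implicit Arguments.
Unset Strict Implicit.
Unset Printing Implicit Defensive.

(** * Measures on tuples are determined by rectangles *)

Section tuple_rectangles.
Context {R : realType} {d : measure_display} {X : measurableType d} {n : nat}.

Definition tuple_rect (A : 'I_n -> set X) : set (n.-tuple X) :=
  [set x | forall i, A i (tnth x i)].

Lemma measurable_tuple_rect (A : 'I_n -> set X) :
  (forall i, measurable (A i)) -> measurable (tuple_rect A).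
Proof.
move=> mA; rewrite [tuple_rect A](_ : _ = \bigcap_(i in [set: 'I_n])
    (fun x : n.-tuple X => tnth x i) @^-1` A i); last first.
  by apply/seteqP; split=> x /= Ax; [move=> i _; exact: Ax|move=> i; exact: Ax].
apply: fin_bigcap_measurable => // i _; rewrite -[_ @^-1` _]setTI.
exact: measurable_tnth.
Qed.

(** Rectangles are stable under intersection and generate the product sigma-algebra, so the
    uniqueness theorem for measures applies. Statements on laws of blocks thereby reduce to products
    of marginal probabilities. *)
Lemma tuple_measure_unique (m1 m2 : {measure set (n.-tuple X) -> \bar R}) :
  (m1 setT < +oo)%E ->
  (forall A : 'I_n -> set X, (forall i, measurable (A i)) ->
    m1 (tuple_rect A) = m2 (tuple_rect A)) ->
  forall E, measurable E -> m1 E = m2 E.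
Proof.
move=> m1oo m12 E mE.
pose C : set (set (n.-tuple X)) :=
  [set D | exists2 A : 'I_n -> set X,
     (forall i, measurable (A i)) & D = tuple_rect A].
have rectT : tuple_rect (fun=> setT) = setT by apply/seteqP; split.
apply: (measure_unique C (fun=> setT)) => //.
- apply/seteqP; split.
    apply: smallest_sub; first exact: smallest_sigma_algebra.
    rewrite -bigcup_seq; apply: bigcup_sub => i _ _ [A mA <-].
    (* A generator constrains the single coordinate [i]; it is the rectangle whose other sides are
       the whole space. *)
    apply: sub_sigma_algebra; exists (fun j => if j == i then A else setT).
      by move=> j; case: ifP.
    rewrite setTI; apply/seteqP; split=> x /= Ax; last by have := Ax i; rewrite eqxx.
    by move=> j; case: eqP => // ->.
  apply: smallest_sub; first exact: sigma_algebra_measurable.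
  by move=> _ [A mA ->]; exact: measurable_tuple_rect.
- move=> _ _ [A mA ->] [B mB ->]; exists (fun i => A i `&` B i).
    by move=> i; exact: measurableI.
  apply/seteqP; split=> [x [Ax Bx] i|x ABx]; first by split.
  by split=> i; case: (ABx i).
- by move=> _; exists (fun=> setT).
- by rewrite bigcup_const//; exists 0%N.
- by move=> _ [A mA ->]; exact: m12.
Qed.

End tuple_rectangles.

(** * Blocks of an i.i.d. sequence: common law, independence, Fubini *)

Section iid_blocks.
Context {R : realType} {d dW : measure_display} {X : measurableType d}
  {W : measurableType dW}.
Variables (Q : probability W R) (P : probability X R) (Xs : nat -> {mfun W >-> X}).

Lemma measurable_block i m : measurable_fun [set: W] (block Xs i m).
Proof.
apply/measurable_fun_tnthP => j.
by rewrite (_ : _ \o _ = Xs (i + j)%N)//; apply/funext => w /=; rewrite tnth_mktuple.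
Qed.

HB.instance Definition _ i m :=
  isMeasurableFun.Build _ _ _ _ (block Xs i m) (@measurable_block i m).

Hypothesis iidXs : iid Q P Xs.

(** Independence is put in terms of duplicate-free lists because index ranges of blocks can then be
    concatenated. *)
Lemma iid_seq (s : seq nat) (A : nat -> set X) : uniq s ->
  (forall p, measurable (A p)) ->
  Q [set w | forall p, p \in s -> A p (Xs p w)] = (\prod_(p <- s) P (A p))%E.
Proof.
move=> us mA; have [XsP indep] := iidXs.
have := indep [fset p in s]%fset A mA.
rewrite (perm_big s)/=; last first.
  by apply: uniq_perm => //[|p]; rewrite ?fset_uniq ?inE.
under eq_bigr do rewrite XsP//.
move=> <-; congr (Q _); apply/seteqP; split=> w /= wA p; have := wA p;
  by rewrite /= !inE.
Qed.

Lemma iid_two_blocks i m j l (A : 'I_m -> set X) (B : 'I_l -> set X) :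
  (i + m <= j)%N || (j + l <= i)%N ->
  (forall a, measurable (A a)) -> (forall b, measurable (B b)) ->
  Q (block Xs i m @^-1` tuple_rect A `&` block Xs j l @^-1` tuple_rect B) =
  ((\prod_(a < m) P (A a)) * (\prod_(b < l) P (B b)))%E.
Proof.
move=> ijml mA mB.
(* The two families of sides are glued into one family indexed by sample positions. As the ranges
   are disjoint, the first test never captures a position of the second block; positions outside
   both ranges are unconstrained. *)
pose AB p := if (i <= p < i + m)%N
  then if insub (p - i)%N is Some a then A a else setT
  else if insub (p - j)%N is Some b then B b else setT.
have mAB p : measurable (AB p).
  by rewrite /AB; case: ifP => _; case: insubP.
have ABA (a : 'I_m) : AB (i + a)%N = A a.
  rewrite /AB leq_addr ltn_add2l ltn_ord/= addKn insubT//= => am.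
  by congr A; exact: val_inj.
have ABB (b : 'I_l) : AB (j + b)%N = B b.
  rewrite /AB ifF; last first.
    apply/negP => /andP[ij jm]; case/orP: ijml => ml.
      by move: jm; rewrite ltnNge (leq_trans ml)// leq_addr.
    by move: ij; rewrite leqNgt (leq_trans _ ml)// ltn_add2l.
  by rewrite addKn insubT//= => am; congr B; exact: val_inj.
have uij : uniq (iota i m ++ iota j l).
  rewrite cat_uniq !iota_uniq andbT/=; apply/hasPn => p; rewrite !mem_iota.
  move=> /andP[jp pj]; apply/negP => /andP[ip pi].
  case/orP: ijml => ml.
    by move: pi; rewrite ltnNge (leq_trans ml).
  by move: pj; rewrite ltnNge (leq_trans ml).
have := iid_seq uij mAB; rewrite big_cat/=.
have prodE p q : (\prod_(r <- iota p q) P (AB r) = \prod_(c < q) P (AB (p + c)%N))%E.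
  by rewrite -[in LHS](addn0 p) iotaDl big_map -{1}[q]subn0 -/(index_iota 0 q) big_mkord.
rewrite !prodE (eq_bigr (fun a => P (A a))) => [|a _]; last by rewrite ABA.
rewrite [X in (_ * X)%E](eq_bigr (fun b => P (B b))) => [|b _]; last by rewrite ABB.
move=> <-; congr (Q _); apply/seteqP; split=> w /=.
- move=> [wA wB] p; rewrite mem_cat => /orP[]; rewrite mem_iota => /andP[].
    move=> ip pm; have pim : (p - i < m)%N by rewrite ltn_subLR.
    have := wA (Ordinal pim); rewrite -ABA tnth_mktuple/= subnKC//.
  move=> ip pm; have pim : (p - j < l)%N by rewrite ltn_subLR.
  have := wB (Ordinal pim); rewrite -ABB tnth_mktuple/= subnKC//.
- move=> wAB; split=> a; rewrite tnth_mktuple.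
    rewrite -ABA; apply: wAB; rewrite mem_cat mem_iota leq_addr ltn_add2l.
    by rewrite ltn_ord.
  rewrite -ABB; apply: wAB; rewrite mem_cat !mem_iota leq_addr ltn_add2l.
  by rewrite ltn_ord orbT.
Qed.

Lemma iid_block_rect i m (A : 'I_m -> set X) : (forall a, measurable (A a)) ->
  Q (block Xs i m @^-1` tuple_rect A) = (\prod_(a < m) P (A a))%E.
Proof.
(* The second block is taken empty, so its product is 1. *)
move=> mA; have := @iid_two_blocks i m (i + m) 0 A (fun=> setT).
rewrite leqnn big_ord0 mule1 => <- //; congr (Q _); apply/seteqP.
by split=> [w /= wA|w []//]; split=> // -[].
Qed.

Lemma iid_block_law i m E : measurable E ->
  Q (block Xs i m @^-1` E) = Q (block Xs 0 m @^-1` E).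
Proof.
move: E; apply: (tuple_measure_unique (m1 := distribution Q (block Xs i m))
  (m2 := distribution Q (block Xs 0 m))).
  by rewrite /= /distribution /pushforward preimage_setT probability_setT ltry.
by move=> A mA; rewrite /= /distribution /pushforward !iid_block_rect.
Qed.

(** For fixed [D] both sides are finite measures in [E]: the image under [f] of [Q] restricted to
    [D], and the law of [f] scaled by [Q D]. Agreement on rectangles therefore suffices. *)
Lemma independent_of_tuple n (f : {mfun W >-> n.-tuple X}) (D : set W) :
  measurable D ->
  (forall A : 'I_n -> set X, (forall i, measurable (A i)) ->
    Q (f @^-1` tuple_rect A `&` D) = (Q (f @^-1` tuple_rect A) * Q D)%E) ->
  forall E, measurable E -> Q (f @^-1` E `&` D) = (Q (f @^-1` E) * Q D)%E.
Proof.
move=> mD indep E mE; rewrite muleC.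
have QD0 : 0 <= fine (Q D) by rewrite fine_ge0.
have QDE : Q D = (fine (Q D))%:E by rewrite fineK// fin_num_measure.
rewrite QDE.
apply: (tuple_measure_unique (m1 := pushforward (mrestr Q mD) f)
  (m2 := mscale (NngNum QD0) (distribution Q f))) => //.
  rewrite /= /pushforward /mrestr preimage_setT setTI.
  by rewrite (le_lt_trans (probability_le1 _ _))// ltry.
by move=> A mA; transitivity (Q D * Q (f @^-1` tuple_rect A))%E;
  [rewrite muleC; exact: indep|rewrite [in LHS]QDE].
Qed.

(** [independent_of_tuple] is used twice: first [E] is reduced to a rectangle with [F] fixed, then
    [F] is reduced to a rectangle with that of the first block fixed. *)
Lemma iid_blocks_independent i m j l E F : (i + m <= j)%N || (j + l <= i)%N ->
  measurable E -> measurable F ->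
  Q (block Xs i m @^-1` E `&` block Xs j l @^-1` F) =
  (Q (block Xs i m @^-1` E) * Q (block Xs j l @^-1` F))%E.
Proof.
move=> ijml mE mF.
have mblock p q D : measurable D -> measurable (block Xs p q @^-1` D).
  by move=> mD; rewrite -[_ @^-1` _]setTI; exact: measurable_block.
apply: (@independent_of_tuple _ (block Xs i m)) => //; first exact: mblock.
move=> A mA; rewrite setIC muleC.
have mQA := mblock i m _ (measurable_tuple_rect mA).
apply: (@independent_of_tuple _ (block Xs j l)) => // B mB.
by rewrite setIC iid_two_blocks// !iid_block_rect// muleC.
Qed.

(* Fubini: the law of the pair is the product of the laws. *)
Lemma iid_blocks_section i m j l dT (T : measurableType dT)
    (f : {mfun l.-tuple X >-> T}) (S : set (m.-tuple X * T)) (D : set T)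
    (delta : R) :
  (i + m <= j)%N || (j + l <= i)%N -> 0 <= delta ->
  measurable S -> measurable D ->
  (forall y, ~ D y -> (Q (block Xs 0 m @^-1` ysection S y) <= delta%:E)%E) ->
  (Q [set w | S (block Xs i m w, f (block Xs j l w))] <=
   delta%:E + Q [set w | D (f (block Xs 0 l w))])%E.
Proof.
move=> ijml delta0 mS mD QS.
pose g := (fun w => (block Xs i m w, f (block Xs j l w))).
have mg : measurable_fun setT g.
  apply: measurable_fun_pair; first exact: measurable_block.
  by apply: measurableT_comp => //; exact: measurable_block.
pose gm : {mfun W >-> (m.-tuple X * T)%type} := mfun_Sub (mem_set mg).
pose f2 := f \o block Xs j l.
have mf2 : measurable_fun setT f2.
  by apply: measurableT_comp => //; exact: measurable_block.
pose f2m : {mfun W >-> T} := mfun_Sub (mem_set mf2).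
have fE E : measurable E -> measurable (f @^-1` E).
  by move=> mE; rewrite -[_ @^-1` _]setTI; exact: (@measurable_funPT _ _ _ _ f).
pose mu1 : probability _ R := distribution Q (block Xs i m).
pose mu2 : probability _ R := distribution Q f2m.
have gE E F : measurable E -> measurable F ->
    distribution Q gm (E `*` F) = (mu1 E * mu2 F)%E.
  move=> mE mF.
  rewrite /mu1 /mu2 /= /distribution /pushforward /=.
  rewrite (_ : f2 @^-1` F = block Xs j l @^-1` (f @^-1` F))//.
  by rewrite -iid_blocks_independent//; exact: fE.
rewrite [leLHS](_ : _ = distribution Q gm S)//.
(* By independence the law of the pair is the product of the laws. It is then written as an integral
   over the second coordinate, so that sections of [S] are taken at a fixed value of [f]. *)
rewrite -(product_measure_unique gE)//.
rewrite (@product_measure_unique _ _ _ _ _ mu1 mu2 (mu1 \x^ mu2)%E)//; last first.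
  by move=> E F mE mF /=; rewrite product_measure2E.
rewrite /product_measure2/=.
have -> : Q [set w | D (f (block Xs 0 l w))] = mu2 D.
  exact/esym/(iid_block_law j (fE _ mD)).
rewrite -[X in (_ + X)%E]mul1e.
(* The section probability is at most 1 on [D] and at most [delta] off [D]. *)
apply: (@le_trans _ _ (\int[mu2]_y (delta%:E + (\1_D y)%:E))%E).
  apply: ge0_le_integral => //.
  - exact: (measurable_fun_ysection mu1 mS).
  - by apply: emeasurable_funD => //; apply/measurable_EFinP.
  move=> y _ /=; have [Dy|nDy] := pselect (D y).
    rewrite indicE mem_set//= (le_trans (probability_le1 _ _))//.
      exact: measurable_ysection.
    by rewrite leeDr// lee_fin.
  rewrite indicE memNset//= adde0 (le_trans _ (QS _ nDy))//.
  by rewrite -(iid_block_law i (measurable_ysection _ mS)).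
rewrite ge0_integralD//.
- rewrite integral_cst//= integral_indic// setIT mul1e leeD//.
  by rewrite probability_setT mule1.
- by apply/measurable_EFinP; exact: measurable_indic.
Qed.
End iid_blocks.

(** * Calculus of convergence to zero in probability *)

Section convergence_in_probability.
Context {R : realType} {dW : measure_display} {W : measurableType dW}.
Variable Q : probability W R.
Implicit Types Z : nat -> W -> R.

Lemma measurable_ge_norm (f : W -> R) (eps : R) : measurable_fun setT f ->
  measurable [set w | eps <= `|f w|].
Proof.
move=> mf; rewrite (_ : [set _ | _] = (fun w => `|f w|) @^-1` `[eps, +oo[).
  by rewrite -[_ @^-1` _]setTI; apply: (measurableT_comp (@normr_measurable R setT)).
by apply/seteqP; split=> w /=; rewrite in_itv/= andbT.
Qed.

Lemma cvg0_in_probabilityP Z : (forall n, measurable_fun setT (Z n)) ->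
  cvg0_in_probability Q Z <->
  forall eps delta : R, 0 < eps -> 0 < delta ->
    \forall n \near \oo, (Q [set w | (eps <= `|Z n w|)%R] <= delta%:E)%E.
Proof.
move=> mZ; have Qfin eps n : Q [set w | eps <= `|Z n w|] \is a fin_num.
  by rewrite fin_num_measure//; exact: measurable_ge_norm.
split=> [Z0 eps delta eps0 delta0|Z0 eps eps0].
  have /fine_cvgP[_ /cvgrPdist_le/(_ _ delta0)] := Z0 _ eps0.
  apply: filterS => n /=; rewrite sub0r normrN ger0_norm ?fine_ge0//.
  by rewrite -lee_fin fineK.
apply/fine_cvgP; split; first exact: nearW.
apply/cvgrPdist_le => delta delta0; apply: filterS (Z0 _ _ eps0 delta0) => n.
by rewrite /= sub0r normrN ger0_norm ?fine_ge0// -lee_fin fineK.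
Qed.

Lemma cvg0_in_probability_near Z1 Z2 : (\forall n \near \oo, Z1 n = Z2 n) ->
  cvg0_in_probability Q Z1 -> cvg0_in_probability Q Z2.
Proof.
move=> Z12 Z10 eps eps0; apply: cvg_trans (Z10 _ eps0); apply: near_eq_cvg.
by apply: filterS Z12 => n ->.
Qed.

Lemma cvg0_in_probabilityD Z1 Z2 : (forall n, measurable_fun setT (Z1 n)) ->
  (forall n, measurable_fun setT (Z2 n)) ->
  cvg0_in_probability Q Z1 -> cvg0_in_probability Q Z2 ->
  cvg0_in_probability Q (fun n w => Z1 n w + Z2 n w).
Proof.
move=> mZ1 mZ2 /(cvg0_in_probabilityP mZ1) Z10 /(cvg0_in_probabilityP mZ2) Z20.
have mZ n : measurable_fun setT (fun w => Z1 n w + Z2 n w).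
  exact: measurable_funD.
apply/cvg0_in_probabilityP => // eps delta eps0 delta0.
have eps20 : 0 < eps / 2 by rewrite divr_gt0.
have delta20 : 0 < delta / 2 by rewrite divr_gt0.
have Z1n := Z10 _ _ eps20 delta20; have Z2n := Z20 _ _ eps20 delta20.
near=> n.
have mge1 := measurable_ge_norm (eps / 2) (mZ1 n).
have mge2 := measurable_ge_norm (eps / 2) (mZ2 n).
apply: (@le_trans _ _ (Q ([set w | (eps / 2 <= `|Z1 n w|)%R] `|`
                          [set w | (eps / 2 <= `|Z2 n w|)%R]))).
  apply: le_measure; rewrite ?inE//.
  - exact: measurable_ge_norm.
  - exact: measurableU.
  move=> w /= epsZ; have := ler_normD (Z1 n w) (Z2 n w).
  by case: (lerP (eps / 2) `|Z1 n w|) => ?; [left|right; lra].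
rewrite (le_trans (measureU2 _ _ _))// [delta]splitr EFinD leeD//.
- by near: n.
- by near: n.
Unshelve. all: by end_near. Qed.

Lemma cvg0_in_probabilityM (c : nat -> R) Z :
  (forall n, measurable_fun setT (Z n)) -> (\forall n \near \oo, `|c n| <= 1) ->
  cvg0_in_probability Q Z -> cvg0_in_probability Q (fun n w => c n * Z n w).
Proof.
move=> mZ c1 /(cvg0_in_probabilityP mZ) Z0.
have mcZ n : measurable_fun setT (fun w => c n * Z n w).
  exact: measurable_funM.
apply/cvg0_in_probabilityP => // eps delta eps0 delta0.
apply: filterS2 c1 (Z0 _ _ eps0 delta0) => n c1n; apply: le_trans.
apply: le_measure; rewrite ?inE; try exact: measurable_ge_norm.
by move=> w /= /le_trans; apply; rewrite normrM ler_piMl.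
Qed.

End convergence_in_probability.

(** * Substituting an estimator from an independent block for the parameter *)

Lemma open_norm_gt (R : realType) (V : normedModType R) (x0 : V) (c M : R) :
  open [set x | M < `|c *: (x - x0)|].
Proof.
apply: (@open_comp _ _ (fun x => `|c *: (x - x0)|) [set y | M < y]);
  last exact: open_gt.
move=> x _; apply: cvg_norm; apply: cvgZl_tmp.
by apply: cvgB; [exact: cvg_id|exact: cvg_cst].
Qed.

Lemma open_borel (T : ptopologicalType) (A : set T) :
  open A -> measurable (A : set (borel T)).
Proof. exact: sub_sigma_algebra. Qed.

Section plug_in.
Context {R : realType} {d dW : measure_display} {X : measurableType d}
  {W : measurableType dW} {k : nat}.
Variables (Q : probability W R) (P : probability X R)
  (Xs : nat -> {mfun W >-> X}) (Theta : set 'rV[R]_k) (th0 : 'rV[R]_k).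
Variable F : forall n, n.-tuple X -> 'rV[R]_k -> R.

Hypothesis Fcvg0 : forall th, root_n_bounded Theta th0 th ->
  cvg0_in_probability Q (fun n w => F (block Xs 0 n w) (th n)).
Hypothesis Theta0 : Theta th0.
Hypothesis oTheta : open Theta.
Hypothesis mF : forall n,
  measurable_fun (setT `*` (Theta : set (borel 'rV[R]_k)))
    (fun p : n.-tuple X * borel 'rV[R]_k => F p.1 p.2).

Lemma measurable_plug_in n dY (Y : measurableType dY) (f : Y -> n.-tuple X)
    (g : Y -> 'rV[R]_k) :
  measurable_fun setT f -> measurable_fun setT (g : Y -> borel 'rV[R]_k) ->
  (forall y, Theta (g y)) -> measurable_fun setT (fun y => F (f y) (g y)).
Proof.
move=> mf mg Tg.
apply: (measurable_comp (F := setT `*` (Theta : set (borel 'rV[R]_k)))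
  (f := fun p : n.-tuple X * borel 'rV[R]_k => F p.1 p.2)
  (g := fun y => (f y, g y : borel _))) => //.
- by apply: measurableX => //; exact: open_borel.
- by move=> _ [y _ <-]; split => //=.
- exact: measurable_fun_pair.
Qed.

(* Otherwise choosing a bad parameter for each [n] would give a
   root-n-bounded sequence violating [Fcvg0]. *)
Lemma cvg0_uniform (M eps delta : R) : 0 < eps -> 0 < delta ->
  \forall n \near \oo, forall th, Theta th ->
    `|Num.sqrt n%:R *: (th - th0)| <= M ->
    (Q [set w | (eps <= `|F (block Xs 0 n w) th|)%R] <= delta%:E)%E.
Proof.
move=> eps0 delta0.
pose bad n := [set th | [/\ Theta th, `|Num.sqrt n%:R *: (th - th0)| <= M
  & ~ (Q [set w | (eps <= `|F (block Xs 0 n w) th|)%R] <= delta%:E)%E]].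
(* Where no bad parameter exists the value is [th0], which keeps the sequence in [Theta] and at
   distance 0 from [th0]. *)
pose th n := xget th0 (bad n).
have Tth n : Theta (th n) by rewrite /th; case: xgetP => [x _ []|].
have thb : root_n_bounded Theta th0 th.
  (* [M] may be negative, while the default value [th0] needs a nonnegative bound. *)
  split=> //; exists (Num.max M 0) => n; rewrite /th; case: xgetP => [x _ [_ + _]|_].
    by rewrite le_max => ->.
  by rewrite subrr scaler0 normr0 le_max lexx orbT.
have mFth n : measurable_fun setT (fun w => F (block Xs 0 n w) (th n)).
  apply: measurable_plug_in => //; exact: measurable_block.
have := Fcvg0 thb; move/(cvg0_in_probabilityP Q mFth)/(_ _ _ eps0 delta0).
apply: filterS => n Qn tht Ttht thtM; apply: contrapT => Qtht.
have : bad n tht by [].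
by move=> /(xgetI th0) [_ _]; exact.
Qed.

Variable t : forall n, n.-tuple X -> 'rV[R]_k.
Hypothesis iidXs : iid Q P Xs.
Hypothesis mt : forall n, measurable_fun setT (@t n : n.-tuple X -> borel 'rV[R]_k).
Hypothesis Tt : forall n x, Theta (@t n x).
Hypothesis t_bounded : bounded_in_probability Q (fun n w =>
    Num.sqrt n%:R *: (t (block Xs 0 n w) - th0)).

(** Consistency is available at the rate of the block of length [l n], whereas [F] is controlled at
    the rate of the block of length [m n]; the comparison of the lengths converts one into the
    other. Half of [delta] pays for the estimator being far from [th0], half for the uniform bound
    on [F]. *)
Lemma plug_in_cvg0 (i m j l : nat -> nat) (C : R) : 0 <= C ->
  (forall n, (i n + m n <= j n)%N || (j n + l n <= i n)%N) ->
  m @ \oo --> \oo -> (\forall n \near \oo, (m n)%:R <= C * (l n)%:R) ->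
  cvg0_in_probability Q (fun n w =>
    F (block Xs (i n) (m n) w) (t (block Xs (j n) (l n) w))).
Proof.
move=> C0 ijml moo mlC.
apply/cvg0_in_probabilityP => [n|eps delta eps0 delta0].
  apply: measurable_plug_in => //.
  exact: (measurableT_comp (@mt (l n))).
have delta20 : 0 < delta / 2 by rewrite divr_gt0.
have [M Mt] := t_bounded delta20.
(* The radius comes from [m n <= C * l n]: a deviation bounded by [M] after scaling by the root of
   [l n] is bounded by [Num.sqrt C * M] after scaling by the root of [m n]. *)
have Funif := moo _ (cvg0_uniform (Num.sqrt C * M) eps0 delta20).
near=> n.
have mlCn : (m n)%:R <= C * (l n)%:R by near: n.
have Fn : forall th, Theta th -> `|Num.sqrt (m n)%:R *: (th - th0)| <= Num.sqrt C * M ->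
    (Q [set w | (eps <= `|F (block Xs 0 (m n) w) th|)%R] <= (delta / 2)%:E)%E.
  by near: n.
pose tn : {mfun (l n).-tuple X >-> borel 'rV[R]_k} := mfun_Sub (mem_set (@mt (l n))).
(* [F] is measurable only over [Theta], so the exceptional set is cut down to [Theta]; nothing is
   lost because [t] takes its values there. *)
pose S : set ((m n).-tuple X * borel 'rV[R]_k) :=
  (setT `*` (Theta : set (borel 'rV[R]_k))) `&`
  [set p | eps <= `|F p.1 p.2|].
pose D : set (borel 'rV[R]_k) := [set th | M < `|Num.sqrt (l n)%:R *: (th - th0)|].
have mS : measurable S.
  rewrite /S (_ : [set p | _] =
    (fun p : (m n).-tuple X * borel 'rV[R]_k => F p.1 p.2) @^-1`
    ((fun x : R => `|x|) @^-1` `[eps, +oo[)).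
    apply: mF.
      by apply: measurableX => //; exact: open_borel.
    by rewrite -[_ @^-1` _]setTI; apply: normr_measurable.
  by apply/seteqP; split=> w /=; rewrite in_itv/= andbT.
have mD : measurable D.
  by apply: (@open_borel 'rV[R]_k); exact: open_norm_gt.
have QS y : ~ D y ->
    (Q (block Xs 0 (m n) @^-1` ysection S y) <= (delta / 2)%:E)%E.
  move=> /negP; rewrite -leNgt normrZ => yM.
  have [Ty|nTy] := pselect (Theta y); last first.
    rewrite (_ : _ @^-1` _ = set0) ?measure0 ?lee_fin ?ltW//.
    by apply/seteqP; split=> w //=; rewrite /ysection/= inE => -[[]].
  rewrite (_ : _ @^-1` _ = [set w | (eps <= `|F (block Xs 0 (m n) w) y|)%R]); last first.
    apply/seteqP; split=> w /=; rewrite /ysection/= inE; first by case.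
    by move=> epsF; split.
  apply: Fn => //; rewrite normrZ.
  rewrite (@le_trans _ _ (Num.sqrt C * (`|Num.sqrt (l n)%:R| * `|y - th0|)))//.
    rewrite mulrA ler_wpM2r// !ger0_norm ?sqrtr_ge0// -sqrtrM//.
    by rewrite ler_wsqrtr.
  by rewrite ler_wpM2l// sqrtr_ge0.
have := iid_blocks_section iidXs tn (ijml n) (ltW delta20) mS mD QS.
rewrite (_ : [set w | S _] =
  [set w | eps <= `|F (block Xs (i n) (m n) w) (t (block Xs (j n) (l n) w))|]); last first.
  by apply/seteqP; split=> w /=; [case|move=> ?; split => //=; split => //; exact: Tt].
move=> /le_trans; apply; rewrite [in leRHS](splitr delta) EFinD leeD2l//.
exact/ltW/Mt.
Unshelve. all: by end_near. Qed.

End plug_in.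

(** * Sizes of the two halves of the sample *)

Lemma limn_esup_lt (R : realType) (v : nat -> R) (a : R) :
  (limn_esup (fun n => (v n)%:E) < a%:E)%E ->
  exists2 c, c < a & \forall n \near \oo, v n <= c.
Proof.
move=> /ereal_inf_lt[_ [A Aoo <-]].
have vA n : A n -> ((v n)%:E <= ereal_sup [set (v m)%:E | m in A])%E.
  by move=> An; apply: ereal_sup_ubound; exists n.
(* The value [+oo] contradicts the strict bound. The value [-oo] leaves [A] empty, so any constant
   below [a] serves. *)
case: (ereal_sup _) vA => [c||] vA; last 2 first.
- by rewrite ltNge leey.
- move=> _; exists (a - 1); first by rewrite ltrBlDr ltrDl.
  by apply: filterS Aoo => n /vA; rewrite leeNy_eq.
by rewrite lte_fin => ca; exists c => //; apply: filterS Aoo => n /vA; rewrite lee_fin.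
Qed.

Lemma limn_einf_gt (R : realType) (v : nat -> R) (a : R) :
  (a%:E < limn_einf (fun n => (v n)%:E))%E ->
  exists2 c, a < c & \forall n \near \oo, c <= v n.
Proof.
rewrite /limn_einf lteNr -EFinN => /(@limn_esup_lt _ (fun n => - v n))[c ca cv].
exists (- c); first by rewrite ltrNr.
by apply: filterS cv => n; rewrite lerNl.
Qed.

Section sample_split.
Context {R : realType}.
Variable lam : nat -> nat.
Hypothesis lam_inf : (0 < limn_einf (fun n => ((lam n)%:R / n%:R : R)%:E))%E.
Hypothesis lam_sup : (limn_esup (fun n => ((lam n)%:R / n%:R : R)%:E) < 1)%E.

Lemma split_proportions : exists2 c : R, 0 < c & \forall n \near \oo,
  [/\ (lam n <= n)%N, c * n%:R <= (lam n)%:R & c * n%:R <= (n - lam n)%:R].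
Proof.
have [a a0 na] := limn_einf_gt lam_inf.
have [b b1 nb] := limn_esup_lt lam_sup.
(* The lower bound [a] on the proportion controls the first half, the upper bound [b] the second. *)
exists (Num.min a (1 - b)); first by rewrite lt_min a0 subr_gt0.
near=> n.
have n0 : 0 < n%:R :> R by rewrite ltr0n; near: n; exact: nbhs_infty_gt.
have an : a <= (lam n)%:R / n%:R by near: n.
have bn : (lam n)%:R / n%:R <= b by near: n.
have {}an : a * n%:R <= (lam n)%:R by rewrite -ler_pdivlMr.
have {}bn : (lam n)%:R <= b * n%:R by rewrite -ler_pdivrMr.
have lamn : (lam n <= n)%N.
  by rewrite -(ler_nat R) (le_trans bn)// ler_piMl// ltW.
split=> //.
  by apply: le_trans an; rewrite ler_pM2r// ge_min lexx.
rewrite natrB// (@le_trans _ _ ((1 - b) * n%:R))//.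
  by rewrite ler_pM2r// ge_min lexx orbT.
by rewrite mulrBl mul1r lerB.
Unshelve. all: by end_near. Qed.

Lemma proportional_cvg_infty (c : R) (m : nat -> nat) : 0 < c ->
  (\forall n \near \oo, c * n%:R <= (m n)%:R) -> m @ \oo --> \oo.
Proof.
move=> c0 cm; apply/cvgnyPge => N; near=> n.
rewrite -(ler_nat R) (@le_trans _ _ (c * n%:R))//; last by near: n.
rewrite mulrC -ler_pdivrMr//; near: n.
exact: nbhs_infty_ger.
Unshelve. all: by end_near. Qed.

End sample_split.

(** * Weak efficiency of the split estimator *)

Theorem corollary5p1 (R : realType) (d : measure_display) (X : measurableType d)
  (k : nat) (H B : completeNormedModType R) (ip : H -> H -> R)
  (Theta : set 'rV[R]_k) (calG : set H)
  (P : 'rV[R]_k -> H -> probability X R)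
  (nu : probability X R -> B) (nut : H -> B)
  (th0 : 'rV[R]_k) (G : H) (B0 : set {scalar B}) (CG : set (R -> H))
  (nudot : H -> B)
  (l1 : 'rV[R]_k -> 'I_k -> X -> R)
  (ldot : 'rV[R]_k -> 'rV[R]_k * H -> X -> R)
  (psi : H -> 'rV[R]_k -> X -> R)
  (u : forall n, n.-tuple X -> 'rV[R]_k -> B)
  (t : forall n, n.-tuple X -> 'rV[R]_k)
  (lam : nat -> nat)
  (dW : measure_display) (W : measurableType dW) (Q : probability W R)
  (Xs : nat -> {mfun W >-> X}) :
  inner_product ip ->
  open Theta -> Theta th0 -> calG G -> B0 `<=` dual B ->
  (forall th g, Theta th -> calG g -> nu (P th g) = nut g) ->
  CG `<=` is_path calG G ->
  iid Q (P th0 G) Xs ->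
  (forall n, measurable_fun setT (t n : n.-tuple X -> borel 'rV[R]_k)) ->
  (forall n x, Theta (t n x)) ->
  (forall n, measurable_fun (setT `*` (Theta : set (borel 'rV[R]_k)))
     (fun p : n.-tuple X * borel 'rV[R]_k => u n p.1 p.2 : borel B)) ->
  influence_functions Theta P ip CG G ldot psi ->
  (* (1) *)
  regular_model Theta (P ^~ G) l1 ->
  (forall th, Theta th -> hellinger_derivative Theta P CG G th (ldot th) /\
                          score_decomposition P CG G l1 ldot th) ->
  linear_subspace (tangent_set CG) -> closed (tangent_set CG) ->
  pathwise_derivative CG G nut nudot ->
  (forall th, Theta th ->
     efficient_information P CG G l1 ldot th \in unitmx) ->
  (* (2) *)
  (forall b, dual B b -> \forall th \near th0,
     information_range P ip CG G ldot th (gradient ip CG nudot b)) ->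
  (* (3) *)
  (forall h, tangent_space CG h ->
     (\forall th \near th0, information_range P ip CG G ldot th h) ->
     forall th, root_n_bounded Theta th0 th ->
     cvg0_in_probability Q (fun n w =>
       (Num.sqrt n%:R)^-1 * (\sum_(i < n) psi h (th n) (Xs i w))
       - (Num.sqrt n%:R)^-1 * (\sum_(i < n) psi h th0 (Xs i w)))) ->
  (* (4) *)
  (forall th b, root_n_bounded Theta th0 th -> B0 b ->
     cvg0_in_probability Q (fun n w =>
       Num.sqrt n%:R * (b (u n (block Xs 0 n w) (th n) - nut G)
         - n%:R^-1 * \sum_(i < n)
             psi (gradient ip CG nudot b) (th n) (Xs i w)))) ->
  (* (5) *)
  bounded_in_probability Q (fun n w =>
    Num.sqrt n%:R *: (t n (block Xs 0 n w) - th0)) ->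
  (* (6) *)
  (forall j f, nuisance_tangent_space P CG G ldot th0 f ->
     L2dot (P th0 G) (l1 th0 j) f = 0) ->
  (0 < limn_einf (fun n => ((lam n)%:R / n%:R : R)%:E))%E ->
  (limn_esup (fun n => ((lam n)%:R / n%:R : R)%:E) < 1)%E ->
  forall th b, root_n_bounded Theta th0 th -> B0 b ->
    cvg0_in_probability Q (fun n w =>
      Num.sqrt n%:R * (b (split_estimator u t lam Xs n w - nu (P (th n) G))
        - n%:R^-1 * \sum_(i < n)
            psi (gradient ip CG nudot b) (th n) (Xs i w))).
Proof.
move=> _ oTheta Theta0 calG0 B0dual nuE _ iidXs mt Tt mu psiP _ _ _ _ _ _.
move=> grad_range psi_cvg u_cvg t_bounded _ lam_inf lam_sup th b thb B0b.
have bcont : continuous (b : B -> R) := B0dual _ B0b.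
set h := gradient ip CG nudot b.
have rangeh := grad_range _ (B0dual _ B0b).
have Th : tangent_space CG h by case: (nbhs_singleton rangeh).
have [mpsi _] := psiP _ Th.
have mpsi_at th' : Theta th' -> measurable_fun setT (psi h th').
  move=> Tth'; apply: (measurable_comp
    (F := (Theta : set (borel 'rV[R]_k)) `*` setT)
    (f := fun p : borel 'rV[R]_k * X => psi h p.1 p.2)
    (g := fun x : X => (th' : borel 'rV[R]_k, x))) => //.
  - by apply: measurableX => //; exact: (@open_borel 'rV[R]_k).
  - by move=> _ [x _ <-].
  - exact: measurable_fun_pair.
pose bu n (x : n.-tuple X) th' := b (u n x th' - nut G).
have mbu n : measurable_fun (setT `*` (Theta : set (borel 'rV[R]_k)))
    (fun p : n.-tuple X * borel 'rV[R]_k => bu n p.1 p.2).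
  have mb : measurable_fun setT (b : borel B -> R).
    apply: (measurability _ (RGenOpens.measurableE R)) => _ [_ [a [a' ->]] <-].
    rewrite setTI; apply: (@open_borel B).
    by apply: open_comp => [x _|]; [exact: bcont|exact: interval_open].
  (* Additivity of [b] moves the subtraction from [B] to the real line. *)
  under eq_fun do rewrite /bu raddfB.
  apply: measurable_funB => //.
  exact: (measurableT_comp mb (mu n)).
pose F n (x : n.-tuple X) th' := Num.sqrt n%:R * bu n x th'
  - (Num.sqrt n%:R)^-1 * \sum_(i < n) psi h th0 (tnth x i).
have mF n : measurable_fun (setT `*` (Theta : set (borel 'rV[R]_k)))
    (fun p : n.-tuple X * borel 'rV[R]_k => F n p.1 p.2).
  apply: measurable_funB; apply: measurable_funM => //; first exact: mbu.
  apply: measurable_sum => i; apply: measurable_funTS.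
  apply: (measurableT_comp (mpsi_at _ Theta0)).
  exact: (measurableT_comp (measurable_tnth i)).
have mpsi_sum n th' : Theta th' ->
    measurable_fun setT (fun w => \sum_(i < n) psi h th' (Xs i w)).
  by move=> Tth'; apply: measurable_sum => i; exact: (measurableT_comp (mpsi_at _ Tth')).
have [Tth _] := thb.
have mpsi_diff n th' : Theta th' -> measurable_fun setT (fun w =>
    (Num.sqrt n%:R)^-1 * (\sum_(i < n) psi h th' (Xs i w))
    - (Num.sqrt n%:R)^-1 * (\sum_(i < n) psi h th0 (Xs i w))).
  by move=> Tth'; apply: measurable_funB; apply: measurable_funM => //; exact: mpsi_sum.
have sqrtV (n : nat) : Num.sqrt n%:R * n%:R^-1 = (Num.sqrt n%:R)^-1 :> R.
  (* At [n = 0] both sides vanish, since the inverse of 0 is 0. *)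
  have [->|n0] := posnP n; first by rewrite sqrtr0 mul0r invr0.
  have s0 : Num.sqrt n%:R != 0 :> R by rewrite gt_eqF// sqrtr_gt0 ltr0n.
  by rewrite -[in n%:R^-1](sqr_sqrtr (ler0n R n)) expr2 invfM mulrA divff// mul1r.
have Fcvg0 th' : root_n_bounded Theta th0 th' ->
    cvg0_in_probability Q (fun n w => F n (block Xs 0 n w) (th' n)).
  move=> thb'; have [Tth' _] := thb'.
  have := cvg0_in_probabilityD _ _ (u_cvg _ _ thb' B0b) (psi_cvg _ Th rangeh _ thb').
  rewrite (_ : (fun n w => _ + _) = (fun n w => F n (block Xs 0 n w) (th' n))).
    apply.
    - move=> n; apply: measurable_funM => //; apply: measurable_funB => //.
        exact: (measurable_plug_in oTheta mbu).
      by apply: measurable_funM => //; exact: mpsi_sum.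
    - by move=> n; exact: mpsi_diff.
  (* In the sum of the two error terms the influence functions at [th' n] cancel, leaving those at
     [th0]. *)
  apply/funext => n; apply/funext => w; rewrite /F /bu mulrBr mulrA sqrtV subrKA.
  by congr (_ - _ * _); apply: eq_bigr => i _; rewrite tnth_mktuple.
have [c c0 split_c] := split_proportions lam_inf lam_sup.
have plug := plug_in_cvg0 Fcvg0 Theta0 oTheta mF iidXs mt Tt t_bounded.
(* The constant comparing block lengths is [c^-1]: each half has at most [n] observations and the
   other at least [c * n]. *)
have cV0 : 0 <= c^-1 by rewrite invr_ge0 ltW.
pose c1 n : R := Num.sqrt (lam n)%:R / Num.sqrt n%:R.
pose c2 n : R := Num.sqrt (n - lam n)%:R / Num.sqrt n%:R.
have c_le1 : \forall n \near \oo, `|c1 n| <= 1 /\ `|c2 n| <= 1.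
  near=> n; have [lamn _ _] : [/\ (lam n <= n)%N, c * n%:R <= (lam n)%:R
    & c * n%:R <= (n - lam n)%:R] by near: n.
  have n0 : 0 < Num.sqrt n%:R :> R.
    by rewrite sqrtr_gt0 ltr0n; near: n; exact: nbhs_infty_gt.
  rewrite /c1 /c2 !normrM !normfV !ger0_norm ?sqrtr_ge0// !ler_pdivrMr// !mul1r.
  by split; rewrite ler_wsqrtr// ler_nat// leq_subr.
pose Z1 n w := F _ (block Xs 0 (lam n) w) (t _ (block Xs (lam n) (n - lam n) w)).
pose Z2 n w := F _ (block Xs (lam n) (n - lam n) w) (t _ (block Xs 0 (lam n) w)).
have mZ1 n : measurable_fun setT (Z1 n).
  apply: (measurable_plug_in oTheta mF) => //; exact: (measurableT_comp (mt _)).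
have mZ2 n : measurable_fun setT (Z2 n).
  apply: (measurable_plug_in oTheta mF) => //; exact: (measurableT_comp (mt _)).
have Z10 : cvg0_in_probability Q Z1.
  apply: (plug (fun=> 0%N) lam lam (fun n => n - lam n)%N _ cV0) => [n||].
  - by rewrite add0n leqnn.
  - by apply: (proportional_cvg_infty c0); apply: filterS split_c => n [].
  - apply: filterS split_c => n [lamn _ cn].
    by rewrite mulrC ler_pdivlMr// mulrC (le_trans _ cn)// ler_pM2l// ler_nat.
have Z20 : cvg0_in_probability Q Z2.
  apply: (plug lam (fun n => n - lam n)%N (fun=> 0%N) lam _ cV0) => [n||].
  - by rewrite add0n leqnn orbT.
  - by apply: (proportional_cvg_infty c0); apply: filterS split_c => n [].
  - apply: filterS split_c => n [lamn cn _].
    by rewrite mulrC ler_pdivlMr// mulrC (le_trans _ cn)// ler_pM2l// ler_nat leq_subr.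
pose Z3 n w := (Num.sqrt n%:R)^-1 * (\sum_(i < n) psi h (th n) (Xs i w))
  - (Num.sqrt n%:R)^-1 * (\sum_(i < n) psi h th0 (Xs i w)).
have Z30 : cvg0_in_probability Q Z3 := psi_cvg _ Th rangeh _ thb.
(* [Z1] and [Z2] are centred with influence functions at [th0]; subtracting [Z3] moves the centring
   to [th n]. The identity is claimed only for large [n], where [n] and both block lengths are
   positive. *)
apply: (@cvg0_in_probability_near _ _ _ _
  (fun n w => (c1 n * Z1 n w + c2 n * Z2 n w) + -1 * Z3 n w)); last first.
  have mc1 n : measurable_fun setT (fun w => c1 n * Z1 n w) by exact: measurable_funM.
  have mc2 n : measurable_fun setT (fun w => c2 n * Z2 n w) by exact: measurable_funM.
  apply: cvg0_in_probabilityD => [n|n||].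
  - exact: measurable_funD.
  - by apply: measurable_funM => //; exact: mpsi_diff.
  - apply: cvg0_in_probabilityD => //; apply: cvg0_in_probabilityM => //.
      by apply: filterS c_le1 => n [].
    by apply: filterS c_le1 => n [].
  - apply: (@cvg0_in_probabilityM _ _ _ _ (fun=> -1)) => //.
      by move=> n; exact: mpsi_diff.
    by apply: nearW => n; rewrite normrN1.
near=> n.
have [lamn lam_c nlam_c] : [/\ (lam n <= n)%N, c * n%:R <= (lam n)%:R
  & c * n%:R <= (n - lam n)%:R] by near: n.
have n0 : 0 < n%:R :> R by rewrite ltr0n; near: n; exact: nbhs_infty_gt.
apply/funext => w.
rewrite /Z1 /Z2 /Z3 /c1 /c2 /F /bu /split_estimator nuE//.
set m := lam n; set l := (n - m)%N.
set x1 := block Xs 0 m w; set x2 := block Xs m l w.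
have nE : n%:R = m%:R + l%:R :> R by rewrite -natrD subnKC.
have -> : \sum_(i < n) psi h th0 (Xs i w) =
    \sum_(i < m) psi h th0 (tnth x1 i) + \sum_(i < l) psi h th0 (tnth x2 i).
  rewrite -[in LHS](subnKC lamn) big_split_ord/=; congr (_ + _).
    by apply: eq_bigr => i _; rewrite tnth_mktuple.
  by apply: eq_bigr => i _; rewrite tnth_mktuple.
have -> : b ((m%:R / n%:R) *: u m x1 (t l x2) + (l%:R / n%:R) *: u l x2 (t m x1) - nut G)
    = (m%:R / n%:R) * b (u m x1 (t l x2) - nut G)
      + (l%:R / n%:R) * b (u l x2 (t m x1) - nut G).
  rewrite -!linearZ/= -raddfD/=; congr (b _).
  (* The two weights add up to 1, so [nut G] can be shared between the halves. *)
  rewrite !scalerBr addrACA -opprD -scalerDl -mulrDl -nE divff ?gt_eqF//.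
  by rewrite scale1r.
have m0 : 0 < m%:R :> R by rewrite (lt_le_trans _ lam_c)// mulr_gt0.
have l0 : 0 < l%:R :> R by rewrite (lt_le_trans _ nlam_c)// mulr_gt0.
set b1 := b _; set b2 := b _; set S1 := \sum_(i < m) _; set S2 := \sum_(i < l) _.
set S := \sum_(i < n) _.
have sqE (x : R) : 0 < x -> x = Num.sqrt x ^+ 2 /\ Num.sqrt x != 0.
  by move=> x0; rewrite sqr_sqrtr ?ltW// gt_eqF// sqrtr_gt0.
have [nsq ns0] := sqE _ n0; have [msq ms0] := sqE _ m0; have [lsq ls0] := sqE _ l0.
(* With the roots as nonzero variables whose squares are the sample sizes, the remaining identity is
   one of rational functions. *)
move: (Num.sqrt n%:R) (Num.sqrt m%:R) (Num.sqrt l%:R) nsq ns0 msq ms0 lsq ls0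
  => sn sm sl nsq ns0 msq ms0 lsq ls0.
rewrite nsq msq lsq; field.
by rewrite ns0 ms0 ls0.
Unshelve. all: by end_near. Qed.
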